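(* For every bipartite graph $G$, $$a(G)-\alpha(G)\le 2+\mu(G)-2\sqrt{1+\mu(G)} .$$
   Context: All graphs are finite, undirected, without loops or multiple edges. For a graph $G$, $m(G)$ is its number of edges, $\alpha(G)$ is its independence number, and $\mu(G)$ is its matching number (maximum size of a set of edges no two of which share a vertex). If $d_1\le d_2\le\cdots\le d_n$ is the degree sequence of $G$, the annihilation number $a(G)$ is the largest integer $k\in\{0,\dots,n\}$ such that $\sum_{i=1}^k d_i\le m(G)$. *)

(* Defs.v *)
From mathcomp Require Import all_boot all_order all_algebra.
Set Implicit Arguments.
Unset Strict Implicit.
Unset Printing Implicit Defensive.

Record sgraph := SGraph {
  vertex :> finType;
  adj : rel vertex;
  adj_sym : symmetric adj;
  adj_irrefl : irreflexive adj
}.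

Section Invariants.

Variable G : sgraph.

(* An edge is the two-element set of its ends; irreflexivity of [adj] ensures
   that the two ends are distinct. *)
Definition edges : {set {set G}} :=
  [set f : {set G} | [exists x : G, [exists y : G, adj x y && (f == [set x; y])]]].

Definition num_edges : nat := #|edges|.

Definition bipartite : Prop :=
  exists A : {set G}, forall x y : G, adj x y -> (x \in A) != (y \in A).

Definition independent (A : {set G}) : bool :=
  [forall x in A, forall y in A, ~~ adj x y].

Definition independence_number : nat :=
  \max_(A : {set G} | independent A) #|A|.

Definition matching (M : {set {set G}}) : bool :=
  (M \subset edges) && trivIset M.

Definition matching_number : nat :=
  \max_(M : {set {set G}} | matching M) #|M|.

Definition degree (x : G) : nat := #|[set y : G | adj x y]|.

Definition degree_sequence : seq nat := sort leq [seq degree x | x : G].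

(* The range is nonempty, since k = 0 always qualifies. *)
Definition annihilation_number : nat :=
  \max_(k < #|G|.+1 | sumn (take k degree_sequence) <= num_edges) k.

End Invariants.

(* Main.v *)
Require Import Defs.
From mathcomp Require Import all_boot all_order all_algebra.
From mathcomp Require Import zify lra.
Import Order.TTheory GRing.Theory Num.Theory.

(** With [a] the annihilation number, let [S] consist of [a] vertices of
    smallest degree and [T] of the other [t] vertices.  Summing degrees over
    [S] counts the edges inside [S] twice and those inside [T] not at all, so
    the bound by the number of edges says [e(S) <= e(T)], and [e(T) <= t^2/4]
    as the graph is bipartite.  A matching has at most [t] edges meeting [T]
    and at most [e(S)] others, hence [mu <= t + t^2/4], that is
    [2 sqrt (1 + mu) <= t + 2].  König's theorem ([n = alpha + mu]) turns this
    into the claim. *)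

Set Implicit Arguments.
Unset Strict Implicit.

Local Open Scope nat_scope.

(** * Covers, disjoint families and uncrossing in set systems *)

Section SetSystems.

Variable T : finType.
Implicit Types (E M : {set {set T}}) (C S : {set T}).

Definition vertex_cover E C := [forall f in E, ~~ [disjoint f & C]].

Lemma vertex_coverP E C :
  reflect (forall f, f \in E -> exists2 x, x \in f & x \in C) (vertex_cover E C).
Proof.
apply: (iffP forall_inP) => H f /H.
  by case/pred0Pn => x /andP[xf xC]; exists x.
by case=> x xf xC; apply/pred0Pn; exists x; apply/andP.
Qed.

Lemma sum_card_setI E S :
  \sum_(f in E) #|f :&: S| = \sum_(x in S) #|[set f in E | x \in f]|.
Proof.
under eq_bigr do rewrite -sum1_card.
under [RHS]eq_bigr do rewrite -sum1_card.
rewrite (exchange_big_dep (mem S)) /=; last by move=> f x _; rewrite inE => /andP[].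
apply: eq_bigr => x xS; apply: eq_bigl => f.
by rewrite !inE xS andbT.
Qed.

Lemma card_set_in E (P : pred {set T}) : #|[set f in E | P f]| = \sum_(f in E) P f.
Proof.
rewrite -sum1_card big_mkcond [RHS]big_mkcond; apply: eq_bigr => f _.
by rewrite inE; case: (f \in E); case: (P f).
Qed.

Lemma trivIset_sum_card_setI M S :
  trivIset M -> \sum_(f in M) #|f :&: S| <= #|S|.
Proof.
move=> /trivIsetP tM; rewrite sum_card_setI -[leqRHS]sum1_card.
apply: leq_sum => x _; apply/card_le1_eqP => f g.
rewrite !inE => /andP[fM xf] /andP[gM xg]; apply/eqP/negPn/negP => ngf.
by have /disjointFr/(_ xg) := tM g f gM fM ngf; rewrite xf.
Qed.

(** A transversal picks one point from each member; this settles the base case of [koenig]. *)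
Lemma trivIset_vertex_cover M :
  trivIset M -> set0 \notin M -> exists2 C, vertex_cover M C & #|C| <= #|M|.
Proof.
move=> tM M0; have pM : partition M (cover M) by apply/and3P.
have trX := transversalP pM; exists (transversal M (cover M)).
  apply/vertex_coverP => f fM.
  have /and3P[_ _ /forall_inP /(_ f fM) /eqP XfE] := trX.
  have : #|transversal M (cover M) :&: f| > 0 by rewrite XfE.
  by case/card_gt0P => x /setIP[xX xf]; exists x.
by rewrite (card_transversal trX).
Qed.

(** Inclusion-exclusion for [C1] and [C2], applied separately inside and outside [A], with union and
    intersection trading places. *)
Lemma card_uncross (A C1 C2 : {set T}) :
  #|(A :&: (C1 :&: C2)) :|: ((C1 :|: C2) :\: A)|
    + #|(A :&: (C1 :|: C2)) :|: ((C1 :&: C2) :\: A)| = #|C1| + #|C2|.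
Proof.
have cardUdisj (X Y : {set T}) : #|(A :&: X) :|: (Y :\: A)| = #|A :&: X| + #|Y :\: A|.
  rewrite cardsU [_ :&: (_ :\: _)](_ : _ = set0) ?cards0 ?subn0 //.
  by apply/setP => x; rewrite !inE; case: (x \in A); rewrite /= ?andbF.
rewrite !cardUdisj -(cardsUI C1 C2) -(cardsID A (C1 :|: C2)) -(cardsID A (C1 :&: C2)).
by rewrite ![_ :&: A]setIC; lia.
Qed.

End SetSystems.

(** * Edges and degrees *)

Section Graphs.

Variable G : sgraph.
Implicit Types (A C S : {set G}) (E M : {set {set G}}).

Lemma edgesP (f : {set G}) :
  reflect (exists x, exists2 y, adj x y & f = [set x; y]) (f \in edges G).
Proof.
rewrite inE; apply: (iffP existsP) => [[x /existsP[y /andP[xy /eqP ->]]]|[x [y xy ->]]].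
  by exists x, y.
by exists x; apply/existsP; exists y; rewrite xy eqxx.
Qed.

Lemma adj_neq (x y : G) : adj x y -> x != y.
Proof. by apply: contraTneq => ->; rewrite adj_irrefl. Qed.

Lemma edge_at (f : {set G}) x :
  f \in edges G -> x \in f -> exists2 y, adj x y & f = [set x; y].
Proof.
case/edgesP => a [b ab ->]; rewrite !inE => /orP[]/eqP ->; first by exists b.
by exists a; [rewrite adj_sym | rewrite setUC].
Qed.

Lemma card_edge (f : {set G}) : f \in edges G -> #|f| = 2.
Proof. by case/edgesP => x [y /adj_neq xy ->]; rewrite cards2 xy. Qed.

Lemma card_incident (x : G) : #|[set f in edges G | x \in f]| = degree x.
Proof.
rewrite /degree.
have inj : {in [set y | adj x y] &, injective (fun y => [set x; y])}.
  move=> y z; rewrite !inE => xy _ /= /setP/(_ y).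
  by rewrite !inE eqxx orbT eq_sym (negbTE (adj_neq xy)) => /esym/eqP.
rewrite -(card_in_imset inj); apply: eq_card => f.
rewrite inE; apply/andP/imsetP => [[fE xf]|[y]].
  by have [y xy ->] := edge_at fE xf; exists y; rewrite ?inE.
by rewrite inE => xy ->; split; [apply/edgesP; exists x, y | rewrite !inE eqxx].
Qed.

(** * König's theorem and edge counts in bipartite graphs *)

Section Bipartite.

Variable A : {set G}.
Hypothesis hA : forall x y : G, adj x y -> (x \in A) != (y \in A).

(* Induction on [E].  If [f, g] in [E] share a vertex [x], take covers [C1] of
   [E :\ f] and [C2] of [E :\ g].  If they miss [f] and [g], uncrossing them
   along the bipartition gives [D1], which covers [E], and [D2], which covers
   [E] once [x] is added; one of [D1] and [x |: D2] is small enough, because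
   [#|D1| + #|D2| = #|C1| + #|C2|]. *)
Lemma koenig E : E \subset edges G ->
  exists M C, [/\ M \subset E, trivIset M, vertex_cover E C & #|C| <= #|M|].
Proof.
have [n] := ubnP #|E|; elim: n => // n IHn in E *; rewrite ltnS => leEn sE.
have [tE|ntE] := boolP (trivIset E).
  have E0 : set0 \notin E by apply/negP => /(subsetP sE) /card_edge; rewrite cards0.
  by have [C EC leC] := trivIset_vertex_cover tE E0; exists E, C.
have [f [g [fE gE nfg /pred0Pn[x /andP[/= xf xg]]]]] :
    exists f g, [/\ f \in E, g \in E, f != g & ~~ [disjoint f & g]].
  have [|H] := boolP [exists f in E, exists g in E, (f != g) && ~~ [disjoint f & g]].
    by move=> /exists_inP[f fE /exists_inP[g gE /andP[? ?]]]; exists f, g.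
  case/negP: ntE; apply/trivIsetP => f g fE gE nfg; apply/negPn/negP => dfg.
  by case/negP: H; apply/exists_inP; exists f => //; apply/exists_inP; exists g; rewrite ?nfg.
have IH h : h \in E -> exists M C, [/\ M \subset E, trivIset M,
    vertex_cover (E :\ h) C & #|C| <= #|M|].
  move=> hE; have [||M [C [sM tM cC leC]]] := IHn (E :\ h).
  - by rewrite (leq_trans _ leEn) // [leqRHS](cardsD1 h) hE.
  - exact: subset_trans (subD1set _ _) sE.
  by exists M, C; split=> //; apply: subset_trans sM (subD1set _ _).
have cover_add h C : vertex_cover (E :\ h) C -> ~~ [disjoint h & C] -> vertex_cover E C.
  move=> /forall_inP cC hC; apply/forall_inP => k kE.
  by have [->//|nkh] := eqVneq k h; apply: cC; rewrite !inE nkh.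
have [M1 [C1 [sM1 tM1 cC1 leC1]]] := IH f fE.
have [M2 [C2 [sM2 tM2 cC2 leC2]]] := IH g gE.
have [fC1|/cover_add cf] := boolP [disjoint f & C1]; last by exists M1, C1; split; rewrite ?cf.
have [gC2|/cover_add cg] := boolP [disjoint g & C2]; last by exists M2, C2; split; rewrite ?cg.
have [M [sM tM leM1 leM2]] :
    exists M, [/\ M \subset E, trivIset M, #|M1| <= #|M| & #|M2| <= #|M|].
  by have [le12|/ltnW le21] := leqP #|M1| #|M2|; [exists M2 | exists M1].
(* The side containing [x]: the complement of [A] is a bipartition as well. *)
have [B [hB xB]] : exists B : {set G},
    (forall u v, adj u v -> (u \in B) != (v \in B)) /\ x \in B.
  have [xA|xA] := boolP (x \in A); first by exists A.
  by exists (~: A); split=> [u v /hA|]; rewrite !inE ?xA //; do 2 case: (_ \in A).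
set D1 := (B :&: (C1 :&: C2)) :|: ((C1 :|: C2) :\: B).
set D2 := (B :&: (C1 :|: C2)) :|: ((C1 :&: C2) :\: B).
have cardD : #|D1| + #|D2| = #|C1| + #|C2| by exact: card_uncross.
have meets h C u v : h = [set u; v] -> ~~ [disjoint h & C] = (u \in C) || (v \in C).
  move=> ->; apply/idP/idP => [/pred0Pn[w /andP[/=]]|uvC].
    by rewrite !inE => /orP[]/eqP -> ->; rewrite ?orbT.
  by apply/pred0Pn; case/orP: uvC => ?; [exists u|exists v]; rewrite /= !inE eqxx ?orbT.
(* Both [C1] and [C2] cover [h]. Let [u] be its end in [B] and [v] the other. Either [u] is in both
   covers or [v] is in one of them, so [D1] meets [h]; exchanging [u] and [v] gives [D2]. *)
have both h : h \in E -> h != f -> h != g -> ~~ [disjoint h & D1] && ~~ [disjoint h & D2].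
  move=> hE nhf nhg.
  have /edgesP[u [v uv huv]] := subsetP sE h hE.
  have := forall_inP cC1 h; rewrite !inE nhf hE => /(_ isT).
  have := forall_inP cC2 h; rewrite !inE nhg hE => /(_ isT).
  rewrite !(meets _ _ _ _ huv) !inE; move: (hB u v uv).
  by do 6 case: (_ \in _).
have [y xy fxy] := edge_at (subsetP sE f fE) xf.
have [z xz gxz] := edge_at (subsetP sE g gE) xg.
(* As [x] lies in neither cover, [z] is in [C1] and [y] in [C2]. Both are outside [B], hence in
   [D1], which therefore covers [f] and [g]. *)
have := forall_inP cC1 g; rewrite !inE eq_sym nfg gE (meets _ _ _ _ gxz) => /(_ isT) gC1.
have := forall_inP cC2 f; rewrite !inE nfg fE (meets _ _ _ _ fxy) => /(_ isT) fC2.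
have [xC1 xC2] : x \notin C1 /\ x \notin C2.
  by rewrite (disjointFr fC1 xf) (disjointFr gC2 xg).
have [leD1|ltD1] := leqP #|D1| #|M|.
  exists M, D1; split=> //; apply/forall_inP => h hE.
  have [->|nhf] := eqVneq h f.
    move: (hB x y xy) fC2; rewrite (meets _ _ _ _ fxy) !inE xB (negbTE xC1) (negbTE xC2) /=.
    by do 3 case: (_ \in _).
  have [->|nhg] := eqVneq h g.
    move: (hB x z xz) gC1; rewrite (meets _ _ _ _ gxz) !inE xB (negbTE xC1) (negbTE xC2) /=.
    by do 3 case: (_ \in _).
  by case/andP: (both h hE nhf nhg).
(* Otherwise [#|D1| + #|D2|] exceeds [2 * #|M|], hence [#|C1| + #|C2|]. The strict inequality leaves
   room for [x]. *)
have leD2 : #|D2| < #|M|.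
  rewrite ltnNge; apply/negP => /(leq_add ltD1); rewrite addSn cardD ltnNge leq_add //.
    exact: leq_trans leM1.
  exact: leq_trans leM2.
exists M, (x |: D2); split=> //; last first.
  by rewrite cardsU1; apply: leq_trans leD2; rewrite -add1n leq_add2r leq_b1.
apply/vertex_coverP => h hE.
have [->|nhf] := eqVneq h f; first by exists x; rewrite ?setU11.
have [->|nhg] := eqVneq h g; first by exists x; rewrite ?setU11.
have /andP[_ /pred0Pn[w /andP[wh wD]]] := both h hE nhf nhg.
by exists w; rewrite // setU1r.
Qed.

(** The complement of a vertex cover is independent; take the cover from [koenig]. *)
Lemma card_le_independence_matching : #|G| <= independence_number G + matching_number G.
Proof.
have [M [C [sM tM /vertex_coverP cC leC]]] := koenig (subxx _).
have indC : independent (~: C).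
  apply/forall_inP => x xC; apply/forall_inP => y yC; apply/negP => xy.
  have [|w] := cC [set x; y]; first by apply/edgesP; exists x, y.
  by move: xC yC; rewrite !inE => /negbTE xC /negbTE yC /orP[]/eqP ->; rewrite ?xC ?yC.
rewrite -(cardsC C) addnC leq_add //.
  exact: (bigop.bigmax_sup (~: C)).
by apply: leq_trans leC _; apply: (bigop.bigmax_sup M); rewrite // /matching sM.
Qed.

(** Each such edge joins [S :&: A] to [S :\: A], so the product of their sizes bounds the count;
    then AM-GM. *)
Lemma card_edges_inside S : 4 * #|[set f in edges G | f \subset S]| <= #|S| ^ 2.
Proof.
have sub : [set f in edges G | f \subset S]
    \subset [set [set x; y] | x in S :&: A, y in S :\: A].
  apply/subsetP => f; rewrite inE => /andP[/edgesP[x [y xy ->]]].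
  rewrite subUset !sub1set => /andP[xS yS].
  have [xA|xA] := boolP (x \in A); move: (hA xy); rewrite ?xA ?(negbTE xA) => yA.
    by apply: imset2_f; rewrite !inE ?xS ?yS ?xA //= andbT; case: (y \in A) yA.
  by rewrite setUC; apply: imset2_f; rewrite !inE ?xS ?yS ?xA //=; case: (y \in A) yA.
rewrite -(cardsID A S) (leq_trans _ (nat_AGM2 _ _)) // leq_mul2l /= -cardsX.
by rewrite (leq_trans (subset_leq_card sub)) // curry_imset2X leq_imset_card.
Qed.

End Bipartite.

(** * Counting edges against a set of small degree sum *)

Lemma card_edges_inside_compl S : \sum_(x in S) degree x <= num_edges G ->
  #|[set f in edges G | f \subset S]| <= #|[set f in edges G | f \subset ~: S]|.
Proof.
under eq_bigr do rewrite -card_incident.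
rewrite -sum_card_setI /num_edges -sum1_card => degS.
rewrite -(leq_add2l (\sum_(f in edges G) 1)); apply: leq_trans (leq_add degS (leqnn _)).
rewrite !card_set_in -!big_split /=.
(* Edge by edge, [1 + (f \subset S)] equals [#|f :&: S| + (f \subset ~: S)], since [f] has two
   ends. *)
apply: leq_sum => f fE; have := cardsID S f; rewrite (card_edge fE).
rewrite -setD_eq0 -[f \subset ~: S]setD_eq0 [f :\: ~: S]setDE setCK -!cards_eq0.
by case: #|f :&: S| => [|[|p]]; case: #|f :\: S|.
Qed.

Lemma card_matching_le M S : matching M ->
  #|M| <= #|~: S| + #|[set f in edges G | f \subset S]|.
Proof.
move=> /andP[sM tM]; apply: leq_trans (leq_add (trivIset_sum_card_setI (~: S) tM) (leqnn _)).
(* Each [f] contributes at least 1: it meets [~: S] or lies inside [S]. Disjointness of [M] bounds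
   the first terms by [#|~: S|]. *)
apply: (@leq_trans (\sum_(f in M) (#|f :&: ~: S| + (f \subset S)))).
  rewrite -sum1_card; apply: leq_sum => f _.
  by rewrite -setDE -setD_eq0 -cards_eq0; case: #|f :\: S|.
rewrite big_split leq_add2l -card_set_in /=; apply/subset_leq_card/subsetP => f.
by rewrite !inE => /andP[/(subsetP sM)]; rewrite inE => -> ->.
Qed.

Lemma annihilation_set : exists2 S : {set G},
  #|S| = annihilation_number G & \sum_(x in S) degree x <= num_edges G.
Proof.
pose P := [pred k : 'I_#|G|.+1 | sumn (take k (degree_sequence G)) <= num_edges G].
have [|k leS maxE] := @bigop.eq_bigmax_cond _ P (fun k : 'I_#|G|.+1 => k : nat).
  by apply/card_gt0P; exists ord0; rewrite inE /= take0.
rewrite inE /= in leS; have -> : annihilation_number G = k := maxE.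
(* Sorting the vertices themselves by degree turns a prefix of the degree sequence into a set of
   vertices. *)
have degE : degree_sequence G = map (@degree G) (sort (relpre (@degree G) leq) (enum G)).
  by rewrite /degree_sequence sort_map.
set s := sort _ _ in degE.
have us : uniq (take k s) by rewrite take_uniq // sort_uniq enum_uniq.
exists [set x in take k s].
  rewrite cardsE (card_uniqP us) size_takel // size_sort -cardE -ltnS.
  exact: ltn_ord.
by move: leS; rewrite degE -map_take sumnE big_map big_uniq //=; apply: leq_trans; rewrite leq_eqVlt (eq_bigl (mem (take k s))) ?eqxx // => x; rewrite inE.
Qed.

End Graphs.

(** * The matching number bound and the theorem *)

Lemma matching_number_le (G : sgraph) : bipartite G ->
  let t := #|G| - annihilation_number G in 4 * matching_number G <= t ^ 2 + 4 * t.
Proof.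
case=> A hA; have [S <- degS] := annihilation_set G.
rewrite -(cardsC S) addKn /=.
have [|M matM maxE] := @bigop.eq_bigmax_cond _ (@matching G) (fun M => #|M|).
  apply/card_gt0P; exists set0; rewrite unfold_in /matching sub0set.
  by apply/trivIsetP => f g; rewrite inE.
have -> : matching_number G = #|M| := maxE.
have := card_matching_le S matM; have := card_edges_inside_compl degS.
have := card_edges_inside hA (~: S).
set e := #|[set f in edges G | f \subset S]|.
set e' := #|[set f in edges G | f \subset ~: S]|.
move: e e' #|M| #|~: S| => e e' mu t le1 le2 le3.
rewrite (leq_trans (leq_mul (leqnn 4) le3)) // mulnDr addnC leq_add2r.
by rewrite (leq_trans _ le1) // leq_mul2l.
Qed.

Unset Implicit Arguments.

Local Open Scope ring_scope.

Theorem theorem3p2 (R : rcfType) (G : sgraph) (hG : bipartite G) :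
  (annihilation_number G)%:R - (independence_number G)%:R
    <= 2%:R + (matching_number G)%:R
       - 2%:R * Num.sqrt (1 + (matching_number G)%:R) :> R.
Proof.
have := matching_number_le hG; set t := (#|G| - _)%N => /= mu_le.
have le_nat : (annihilation_number G + t <= independence_number G + matching_number G)%N.
  rewrite subnKC; last by apply/bigop.bigmax_leqP => k _; rewrite -ltnS ltn_ord.
  by case: hG => A hA; apply: card_le_independence_matching hA.
(* Both sides are nonnegative, and their squares compare by [mu_le] with 4 added to each side, which
   completes the square [(t + 2) ^ 2]. *)
have sqrt_le : 2%:R * Num.sqrt (1 + (matching_number G)%:R) <= t%:R + 2%:R :> R.
  rewrite -(@ler_pXn2r _ 2) ?nnegrE ?mulr_ge0 ?addr_ge0 ?sqrtr_ge0 //.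
  rewrite exprMn sqr_sqrtr ?addr_ge0 //.
  by move: mu_le; rewrite -(ler_nat R) natrM natrD natrM natrX; lra.
by move: le_nat sqrt_le; rewrite -(ler_nat R) !natrD; lra.
Qed.
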